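(* Let $A$ be a regular system of divisors, $S$ a nonempty subset of $\mathbb N$, and $n\in\mathbb N$. Write $\Phi_{A,S,n}(x)=\sum_{j\ge0}a_{A,S,n}(j)x^j$ (so $a_{A,S,n}(j)=0$ for $j>\varphi_{A,S}(n)$). Then for every positive integer $k$, \[ a_{A,S,n}(k)=(-1)^{\varrho_S(n)}\sum_{\substack{j_1,\dots,j_k\ge0\\ j_1+2j_2+\cdots+kj_k=k}}\ \prod_{d=1}^k(-1)^{j_d}\binom{\mu_{A,S}(n/d)}{j_d}, \] with the convention $\mu_{A,S}(t)=0$ if $t$ is not an integer, and where $\binom{m}{j}=m(m-1)\cdots(m-j+1)/j!$ for $m\in\mathbb Z$.
   Context: A regular system of divisors is a family $A=(A(n))_{n\in\mathbb N}$, where each $A(n)$ is a set of positive divisors of $n$, such that: (i) $A(1)=\{1\}$ and $A(mn)=\{de: d\in A(m), e\in A(n)\}$ whenever $\gcd(m,n)=1$; (ii) for every prime power $p^a$ ($a\ge1$) there is a divisor $t=t_A(p^a)$ of $a$ such that $A(p^{it})=\{1,p^t,\dots,p^{it}\}$ for every $0\le i\le a/t$. $\mu_A$ is the inverse of the constant function $1$ under the $A$-convolution $(f*_Ag)(n)=\sum_{d\in A(n)}f(d)g(n/d)$. For $j\in\mathbb Z$, $(j,n)_A=\max\{d\in\mathbb N: d\mid j,\ d\in A(n)\}$; $\zeta_n=e^{2\pi i/n}$. For $S$ with characteristic function $\varrho_S$, $\mu_{A,S}(n)=\sum_{d\in A(n)}\mu_A(d)\varrho_S(n/d)$ and $\Phi_{A,S,n}(x)=\prod_{1\le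 j\le n,\ (j,n)_A\in S}(x-\zeta_n^j)$, of degree $\varphi_{A,S}(n)=\#\{1\le j\le n:(j,n)_A\in S\}$.
   Formalization: The convention is changed: μ_{A,S}(n/d) is taken as 0 whenever d is not in A(n), not only when n/d is not an integer; the literal formula fails for unitary divisors with S={1}, n=4, k=2 (it gives 2 instead of 1). *)

(* Defs.v *)
From HB Require Import structures.
From mathcomp Require Export all_boot all_order all_algebra.
From mathcomp Require Export all_classical all_reals all_analysis.
From mathcomp Require Export complex.

Set Implicit Arguments.
Unset Strict Implicit.
Unset Printing Implicit Defensive.

Import Order.TTheory GRing.Theory Num.Theory.

Local Open Scope classical_set_scope.
Local Open Scope ring_scope.

(* Families, arithmetical functions and sets of positive integers are indexed
   by nat; their values at 0 are never used. *)
Record regular_system (A : nat -> set nat) : Prop := RegularSystem {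
  regular_dvd : forall n d, (0 < n)%N -> A n d -> (d %| n)%N;
  regular_1 : A 1%N = [set 1%N];
  regular_mul : forall m n, (0 < m)%N -> (0 < n)%N -> coprime m n ->
    A (m * n)%N = [set x | exists d e, [/\ A m d, A n e & x = (d * e)%N]];
  regular_prime_power : forall p a, prime p -> (0 < a)%N ->
    exists2 t, (t %| a)%N &
      forall i, (i <= a %/ t)%N ->
        A (p ^ (i * t))%N = [set x | exists2 l, (l <= i)%N & x = (p ^ (l * t))%N]
}.

Definition Aconv (A : nat -> set nat) (f g : nat -> int) (n : nat) : int :=
  \sum_(d <- divisors n | d \in A n) f d * g (n %/ d)%N.

Definition is_Ainverse (A : nat -> set nat) (f g : nat -> int) : Prop :=
  forall n, (0 < n)%N ->
    Aconv A f g n = (n == 1%N)%:R /\ Aconv A g f n = (n == 1%N)%:R.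

(* The condition mu 0 = 0 only makes the inverse unique as a function on nat. *)
Definition mobiusA (A : nat -> set nat) : nat -> int :=
  xget (fun=> 0) [set mu : nat -> int | mu 0%N = 0 /\ is_Ainverse A (fun=> 1) mu].

Definition rho (S : set nat) (n : nat) : int := (n \in S)%:R.

Definition mobiusAS (A : nat -> set nat) (S : set nat) (n : nat) : int :=
  \sum_(d <- divisors n | d \in A n) mobiusA A d * rho S (n %/ d)%N.

(* mu_{A,S}(n/d), extended by 0 to those d that do not belong to A(n), in
   particular to those for which n/d is not an integer.
   Extending by 0 only when d does not divide n would be wrong:
   for the unitary system (d in A(n) iff d | n and gcd(d, n/d) = 1), S = {1} and
   n = 4, the polynomial PhiAS below is 1 + x + x^2 + x^3, but d = 2, which
   divides 4 and is not in A(4) = {1, 4}, would contribute a spurious factor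
   (1 - x^2)^-1 since mu_{A,S}(2) = -1, and give 2 as coefficient of x^2. *)
Definition mobiusAS_quo (A : nat -> set nat) (S : set nat) (n d : nat) : int :=
  if d \in A n then mobiusAS A S (n %/ d)%N else 0.

Definition gcdA (A : nat -> set nat) (j : int) (n : nat) : nat :=
  \max_(d <- divisors n | (d%:Z %| j)%Z && (d \in A n)) d.

Definition zeta (R : realType) (n : nat) : R[i] :=
  Complex (cos (2 * pi / n%:R)) (sin (2 * pi / n%:R)).

Definition PhiAS (R : realType) (A : nat -> set nat) (S : set nat) (n : nat) :
    {poly R[i]} :=
  \prod_(1 <= j < n.+1 | gcdA A j%:Z n \in S) ('X - (zeta R n ^+ j)%:P).

Definition gbinom (F : numFieldType) (m : int) (j : nat) : F :=
  (\prod_(i < j) (m%:~R - i%:R)) / j`!%:R.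

(* Main.v *)
Require Import Defs.
From mathcomp Require Import ring lra.

Set Implicit Arguments.
Unset Strict Implicit.
Unset Printing Implicit Defensive.

Import Order.TTheory GRing.Theory Num.Theory.

Local Open Scope classical_set_scope.
Local Open Scope ring_scope.

(** For fixed [n], a divisor [d] of [n] lies in [A n] iff for every prime [p]
    the valuation of [d] at [p] is a multiple of a number [t p], and the same
    [t] describes [A m] for all [m] in [A n].  Hence [A n] is closed under
    lcm and under [d |-> n / d], and Moebius inversion gives
    [rho S (gcdA j n) = \sum_(d in A n, d | j) mobiusAS d].  Taking products
    of ['X - zeta ^ j] with these exponents yields
    [PhiAS = \prod_(d in A n) ('X^(n / d) - 1) ^ mobiusAS d], and the sign
    comes from the case [j = n].  To avoid rational functions, each exponent
    is written as a difference [p d - q d] of natural numbers.  The binomial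
    series of [(1 - 'X^d) ^ e] is handled by its truncation modulo
    ['X^(k + 1)], where factors with nonzero constant term cancel. *)

(** * Local structure of a regular system *)

Section RegularSystem.
Local Open Scope nat_scope.
Variables (A : nat -> set nat) (hA : regular_system A).

(** Strong induction on [m], written as [p ^ b * m'] with [p] its least prime factor:
    multiplicativity separates the two factors, and the prime power condition taken at
    [p ^ logn p n], not at [p ^ b], describes the first. This is why one [t] serves all these
    [m]. *)
Lemma regular_lognP n : 0 < n -> exists t : nat -> nat,
  (forall p, t p %| logn p n) /\
  (forall m, m %| n -> (forall p, t p %| logn p m) ->
     forall d, A m d <-> d %| m /\ forall p, t p %| logn p d).
Proof.
move=> n_gt0.
have /choice[t tP] p : exists t, t %| logn p n /\
    (forall i, prime p -> i * t <= logn p n ->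
       A (p ^ (i * t)) = [set x | exists2 l, l <= i & x = p ^ (l * t)]).
  have [->|a_gt0] := posnP (logn p n).
    (* Covers non-primes and primes not dividing [n]: with [t = 1] only [i = 0] remains, and [A 1]
       is [{1}]. *)
    exists 1; split=> // i pp; rewrite muln1 leqn0 => /eqP->.
    rewrite expn0 (regular_1 hA); apply/seteqP; split=> x /=.
      by move=> ->; exists 0.
    by case=> l; rewrite leqn0 => /eqP-> ->.
  have pp : prime p by move: a_gt0; rewrite lognE; case: prime.
  have [t t_dvd tP] := regular_prime_power hA pp a_gt0.
  exists t; split=> // i _ le_it; apply: tP.
  by rewrite leq_divRL // (dvdn_gt0 a_gt0).
exists t; split=> [p|m]; first by case: (tP p).
elim/ltn_ind: m => m IHm m_dvd tm d.
have m_gt0 : 0 < m := dvdn_gt0 n_gt0 m_dvd.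
have [m_le1|m_gt1] := leqP m 1.
  have -> : m = 1 by apply/eqP; rewrite eqn_leq m_le1.
  rewrite (regular_1 hA) /= dvdn1; split; last by case=> /eqP.
  by move=> ->; split=> // p; rewrite logn1 dvdn0.
set p := pdiv m; have pp : prime p := pdiv_prime m_gt1.
set b := logn p m; set m' := m`_p^'.
have mE : m = p ^ b * m' by rewrite /b -p_part partnC.
have [i bE] : exists i, b = i * t p by apply/dvdnP/tm.
have b_le : b <= logn p n by apply: dvdn_leq_log.
have lognC q x : logn q x`_p^' = (q != p) * logn q x.
  have [->|x_gt0] := posnP x; first by rewrite partn0 logn1 logn0 muln0.
  have [->|q_neq] /= := eqVneq q p.
    rewrite mul0n; apply/eqP; rewrite -leqn0 leqNgt logn_gt0 mem_primes.
    rewrite pp part_gt0 /=; apply/negP => p_dvd.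
    have /pnatP-/(_ (part_gt0 _ _))/(_ p pp p_dvd) := part_pnat p^' x.
    by rewrite !inE eqxx.
  rewrite mul1n -{2}(partnC p x_gt0) lognM ?part_gt0 // p_part.
  by rewrite lognX (logn_prime _ pp) (negPf q_neq) muln0.
have b_gt0 : 0 < b by rewrite logn_gt0 mem_primes pp m_gt0 pdiv_dvd.
have m'_lt : m' < m.
  rewrite [ltnRHS]mE -[ltnLHS]mul1n ltn_mul2r part_gt0 /=.
  by rewrite -(expn0 p) ltn_exp2l // prime_gt1.
have m'_dvd : m' %| n by apply: dvdn_trans m_dvd; rewrite mE dvdn_mull.
have tm' q : t q %| logn q m' by rewrite lognC dvdn_mull.
have A_m' := IHm _ m'_lt m'_dvd tm'.
have cop : coprime (p ^ b) m' by rewrite /b -p_part coprime_partC.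
have pb_gt0 : 0 < p ^ b by rewrite expn_gt0 prime_gt0.
have A_pb : A (p ^ b) = [set x | exists2 l, l <= i & x = p ^ (l * t p)].
  by rewrite bE; apply: (tP p).2 => //; rewrite -bE.
rewrite [in A m]mE (regular_mul hA) ?part_gt0 // A_pb /=; split.
- case=> _ [e [[l le_li ->] /A_m'[e_dvd te] ->]]; split.
    by rewrite mE dvdn_mul // bE dvdn_exp2l // leq_mul2r le_li orbT.
  have e_gt0 : 0 < e by rewrite (dvdn_gt0 _ e_dvd) ?part_gt0.
  have pl_gt0 : 0 < p ^ (l * t p) by rewrite expn_gt0 prime_gt0.
  move=> q; rewrite lognM // dvdn_add //.
  rewrite lognX; have [->|q_neq] := eqVneq q p.
    by rewrite (logn_prime _ pp) eqxx muln1 dvdn_mull.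
  by rewrite (logn_prime _ pp) (negPf q_neq) muln0.
- case=> d_dvd td; have d_gt0 : 0 < d := dvdn_gt0 m_gt0 d_dvd.
  have [l lE] : exists l, logn p d = l * t p by apply/dvdnP/td.
  exists (p ^ (l * t p)), d`_p^'; split; last by rewrite -lE -p_part partnC.
    exists l => //; have : logn p d <= b by apply: dvdn_leq_log.
    (* Cancelling [t p] requires it to be nonzero, which holds because [b = i * t p] is positive. *)
    rewrite lE bE leq_mul2r => /orP[/eqP t0|//].
    by move: b_gt0; rewrite bE t0 muln0.
  apply/A_m'; split=> [|q]; last by rewrite lognC dvdn_mull.
  by apply: partn_dvd.
Qed.

Lemma regular_self n : 0 < n -> A n n.
Proof. by case/regular_lognP=> t [tn tP]; apply/tP. Qed.

Lemma regular_divn n d : 0 < n -> A n d -> A n (n %/ d).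
Proof.
move=> n_gt0; have [t [tn tP]] := regular_lognP n_gt0.
case/tP=> // d_dvd td; apply/tP=> //; split; first exact: dvdn_div.
by move=> p; rewrite logn_div // dvdn_sub.
Qed.

(** The valuation of an lcm is the larger of two multiples of [t p]. *)
Lemma regular_lcmn n d e : 0 < n -> A n d -> A n e -> A n (lcmn d e).
Proof.
move=> n_gt0; have [t [tn tP]] := regular_lognP n_gt0.
case/tP=> // d_dvd td /tP[] // e_dvd te; apply/tP=> //; split.
  by rewrite dvdn_lcm d_dvd.
move=> p; rewrite logn_lcm ?(dvdn_gt0 n_gt0) //.
by rewrite /maxn; case: ifP.
Qed.

Lemma regular_subP n d e : 0 < n -> A n d -> A d e <-> A n e /\ e %| d.
Proof.
move=> n_gt0; have [t [tn tP]] := regular_lognP n_gt0.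
case/tP=> // d_dvd td; split.
  case/(tP _ d_dvd td) => e_dvd te; split=> //; apply/tP=> //.
  by split=> //; apply: dvdn_trans d_dvd.
by case=> /tP[] // _ te e_dvd; apply/tP.
Qed.

(** Valuations add, and [t p] divides that of [d]; so it divides the valuation of [e] iff it divides
    that of [d * e]. *)
Lemma regular_quoP n d e : 0 < n -> A n d ->
  A (n %/ d) e <-> A n (d * e).
Proof.
move=> n_gt0; have [t [tn tP]] := regular_lognP n_gt0.
case/tP=> // d_dvd td.
have d_gt0 := dvdn_gt0 n_gt0 d_dvd.
have tq p : t p %| logn p (n %/ d) by rewrite logn_div // dvdn_sub.
have q_gt0 : 0 < n %/ d by rewrite divn_gt0 // dvdn_leq.
rewrite (tP _ (dvdn_div d_dvd) tq) (tP _ (dvdnn n) tn).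
rewrite dvdn_divRL // mulnC; split=> -[de_dvd te]; split=> // p.
  have e_gt0 : 0 < e by move: (dvdn_gt0 n_gt0 de_dvd); rewrite muln_gt0 => /andP[].
  by rewrite lognM // dvdn_add.
have e_gt0 : 0 < e by move: (dvdn_gt0 n_gt0 de_dvd); rewrite muln_gt0 => /andP[].
by have := te p; rewrite lognM // dvdn_addr.
Qed.

End RegularSystem.

(** * Changes of variable over divisors *)

Lemma reindex_uniq_seq (R : Type) (idx : R) (op : Monoid.com_law idx)
    (I J : eqType) (r : seq I) (s : seq J) (h : J -> I) (h' : I -> J)
    (P : pred I) (Q : pred J) (F : I -> R) :
  uniq r -> uniq s ->
  (forall j, j \in s -> Q j -> [/\ h j \in r, P (h j) & h' (h j) = j]) ->
  (forall i, i \in r -> P i -> [/\ h' i \in s, Q (h' i) & h (h' i) = i]) ->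
  \big[op/idx]_(i <- r | P i) F i = \big[op/idx]_(j <- s | Q j) F (h j).
Proof.
move=> Ur Us hP h'P; rewrite -big_filter -[RHS]big_filter -(big_map h xpredT).
apply: perm_big; apply: uniq_perm; first exact: filter_uniq.
  rewrite map_inj_in_uniq ?filter_uniq // => x y.
  rewrite !mem_filter => /andP[Qx sx] /andP[Qy sy] /(congr1 h').
  by have [_ _ ->] := hP _ sx Qx; have [_ _ ->] := hP _ sy Qy.
move=> i; apply/idP/mapP => [|[j]].
  rewrite mem_filter => /andP[Pi ri]; have [s_i Qi hK] := h'P _ ri Pi.
  by exists (h' i); rewrite ?mem_filter ?Qi.
rewrite mem_filter => /andP[Qj sj] ->; have [rj Pj _] := hP _ sj Qj.
by rewrite mem_filter Pj.
Qed.

Section RegularSums.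
Variables (A : nat -> set nat) (hA : regular_system A).
Variables (R : Type) (idx : R) (op : Monoid.com_law idx).

Lemma big_regular_divn n (F : nat -> R) : (0 < n)%N ->
  \big[op/idx]_(d <- divisors n | d \in A n) F d =
  \big[op/idx]_(d <- divisors n | d \in A n) F (n %/ d)%N.
Proof.
move=> n_gt0.
have step d : d \in divisors n -> d \in A n ->
    [/\ (n %/ d)%N \in divisors n, (n %/ d)%N \in A n & (n %/ (n %/ d))%N = d].
  rewrite -!dvdn_divisors // !inE => d_dvd /(regular_divn hA n_gt0) Ad.
  by rewrite divnA // mulKn // dvdn_div.
by apply: (reindex_uniq_seq _ _ (h' := divn n)) => //; apply: divisors_uniq.
Qed.

Lemma big_regular_sub n m (F : nat -> R) : (0 < n)%N -> A n m ->
  \big[op/idx]_(d <- divisors m | d \in A m) F d =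
  \big[op/idx]_(d <- divisors n | (d \in A n) && (d %| m)%N) F d.
Proof.
move=> n_gt0 Am; have m_dvd := regular_dvd hA n_gt0 Am.
have m_gt0 := dvdn_gt0 n_gt0 m_dvd.
apply: (reindex_uniq_seq _ _ (h := id) (h' := id)); try exact: divisors_uniq.
  move=> d _ /andP[]; rewrite -dvdn_divisors // !inE => Ad d_dvd; split=> //.
  exact/(regular_subP hA _ n_gt0 Am).
move=> d; rewrite -!dvdn_divisors // => d_dvd.
rewrite !inE => /(regular_subP hA _ n_gt0 Am)[Ad _].
split=> //; first exact: dvdn_trans m_dvd.
by apply/andP; split=> //; rewrite inE.
Qed.

Lemma big_regular_quo n m (F : nat -> R) : (0 < n)%N -> A n m ->
  \big[op/idx]_(d <- divisors n | (d \in A n) && (m %| d)%N) F d =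
  \big[op/idx]_(d <- divisors (n %/ m) | d \in A (n %/ m)%N) F (m * d)%N.
Proof.
move=> n_gt0 Am; have m_dvd := regular_dvd hA n_gt0 Am.
have m_gt0 := dvdn_gt0 n_gt0 m_dvd.
have q_gt0 : (0 < n %/ m)%N by rewrite divn_gt0 // dvdn_leq.
apply: (reindex_uniq_seq _ _ (h' := divn^~ m)); try exact: divisors_uniq.
  move=> d _; rewrite inE => /(regular_quoP hA _ n_gt0 Am) Amd.
  rewrite mulKn // -dvdn_divisors // (regular_dvd hA n_gt0 Amd).
  by split=> //; rewrite dvdn_mulr // andbT inE.
move=> d; rewrite -!dvdn_divisors // => d_dvd /andP[]; rewrite !inE => Ad md.
have dE : (m * (d %/ m) = d)%N by rewrite mulnC divnK.
split=> //; first by rewrite dvdn_divRL // divnK.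
by apply/(regular_quoP hA _ n_gt0 Am); rewrite dE.
Qed.

(** The condition [m * d \in A n] is symmetric in [m] and [d], the form needed to exchange double
    sums over [A n]. *)
Lemma big_regular_quo_mul n m (F : nat -> R) : (0 < n)%N -> A n m ->
  \big[op/idx]_(d <- divisors (n %/ m) | d \in A (n %/ m)%N) F d =
  \big[op/idx]_(d <- divisors n | (d \in A n) && ((m * d)%N \in A n)) F d.
Proof.
move=> n_gt0 Am; have m_dvd := regular_dvd hA n_gt0 Am.
have Aq := regular_divn hA n_gt0 Am.
rewrite (big_regular_sub _ n_gt0 Aq); apply: eq_bigl => d.
apply/andP/andP; rewrite !inE => -[Ad]; last first.
  by move/(regular_quoP hA _ n_gt0 Am)/(regular_subP hA _ n_gt0 Aq).
by move=> dq; split=> //; apply/(regular_quoP hA _ n_gt0 Am)/(regular_subP hA _ n_gt0 Aq).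
Qed.

End RegularSums.

(** * Moebius inversion and the [A]-gcd *)

Section Mobius.
Variables (A : nat -> set nat) (hA : regular_system A).

(** The inverse is built by the recursion [mu n = [n = 1] - \sum_(d in A n, d < n) mu d]. Existence
    guarantees that [xget] in [mobiusA] does not return its default value. *)
Lemma Ainverse_exists :
  exists mu : nat -> int, mu 0%N = 0 /\ is_Ainverse A (fun=> 1) mu.
Proof.
pose step (f : nat -> int) n : int :=
  (n == 1%N)%:R - \sum_(d <- divisors n | (d \in A n) && (d < n)%N) f d.
pose mu' k := iter k step (fun=> 0).
(* The value at [n] uses only smaller arguments, so [n] iterations already fix it. *)
have mu'E k : forall k' n, (n <= k)%N -> (n <= k')%N -> (0 < n)%N ->
    mu' k n = mu' k' n.
  elim: k => [|k IHk] [|k'] n //=; try by case: n.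
  move=> nk nk' n_gt0; congr (_ - _); rewrite big_seq_cond [RHS]big_seq_cond.
  apply: eq_bigr => d /andP[]; rewrite -dvdn_divisors // => d_dvd /andP[_ dn].
  apply: IHk; last exact: (dvdn_gt0 n_gt0).
    by rewrite -ltnS (leq_trans dn).
  by rewrite -ltnS (leq_trans dn).
have mu'_inv n : (0 < n)%N ->
    \sum_(d <- divisors n | d \in A n) mu' d d = (n == 1%N)%:R.
  move=> n_gt0; have An : n \in A n by rewrite inE; apply: regular_self.
  rewrite big_mkcond (bigD1_seq n) ?divisors_uniq //=; last first.
    by rewrite -dvdn_divisors.
  have -> : mu' n n = step (mu' n.-1) n by rewrite -{1}(prednK n_gt0).
  rewrite An -big_mkcondr /step; set s := (X in _ - X).
  suff -> : \sum_(d <- divisors n | (d != n) && (d \in A n)) mu' d d = s.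
    by rewrite subrK.
  rewrite /s big_seq_cond [RHS]big_seq_cond.
  apply: eq_big => [d|d /andP[]].
    have [|//] := boolP (d \in divisors n); rewrite -dvdn_divisors //= => d_dvd.
    by rewrite ltn_neqAle (dvdn_leq n_gt0 d_dvd) andbT andbC.
  rewrite -dvdn_divisors // => d_dvd /andP[d_neq _].
  have d_lt : (d < n)%N by rewrite ltn_neqAle d_neq (dvdn_leq n_gt0 d_dvd).
  apply: mu'E => //; last exact: (dvdn_gt0 n_gt0).
  by rewrite -ltnS prednK.
exists (fun n => mu' n n); split=> // n n_gt0; rewrite /Aconv.
under eq_bigr do rewrite mul1r.
under [X in _ /\ X = _]eq_bigr do rewrite mulr1.
(* The left and right inverse conditions are exchanged by [d |-> n / d]. *)
by rewrite -(big_regular_divn hA _ (fun d => mu' d d)) // mu'_inv.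
Qed.

Lemma sum_mobiusA n : (0 < n)%N ->
  \sum_(d <- divisors n | d \in A n) mobiusA A d = (n == 1%N)%:R.
Proof.
move=> n_gt0; have [mu muP] := Ainverse_exists.
have [_ /(_ _ n_gt0)[_ <-]] : mobiusA A 0%N = 0 /\ is_Ainverse A (fun=> 1) (mobiusA A).
  exact: (xgetI (P := [set mu | mu 0%N = 0 /\ is_Ainverse A (fun=> 1) mu]) _ muP).
by rewrite /Aconv; apply: eq_bigr => d _; rewrite mulr1.
Qed.

(** Associativity of the convolution [1 * mobiusA * rho], by hand: put [d = e * f] and sum over [e]
    first; the sum of [mobiusA] over [A (n / f)] leaves only [f = n]. *)
Lemma sum_mobiusAS (S : set nat) n : (0 < n)%N ->
  \sum_(d <- divisors n | d \in A n) mobiusAS A S d = rho S n.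
Proof.
move=> n_gt0.
transitivity (\sum_(d <- divisors n | d \in A n)
    \sum_(e <- divisors n | (e \in A n) && (e %| d)%N)
      mobiusA A e * rho S (d %/ e)%N).
  by apply: eq_bigr => d; rewrite inE => Ad; rewrite -(big_regular_sub hA).
rewrite (exchange_big_dep (fun e => e \in A n)) /=; last by move=> d e _ /andP[].
transitivity (\sum_(e <- divisors n | e \in A n)
    \sum_(f <- divisors n | (f \in A n) && ((e * f)%N \in A n))
      mobiusA A e * rho S f).
  apply: eq_bigr => e eA; have /set_mem Ae := eA.
  have e_gt0 := dvdn_gt0 n_gt0 (regular_dvd hA n_gt0 Ae).
  rewrite (eq_bigl (fun d => (d \in A n) && (e %| d)%N)); last by move=> d; rewrite eA.
  rewrite (big_regular_quo hA) // -(big_regular_quo_mul hA) //.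
  by apply: eq_bigr => f _; rewrite mulKn.
rewrite (exchange_big_dep (fun f => f \in A n)) /=; last by move=> e f _ /andP[].
transitivity (\sum_(f <- divisors n | f \in A n)
    (n %/ f == 1)%N%:R * rho S f).
  apply: eq_bigr => f fA; have /set_mem Af := fA.
  have f_dvd := regular_dvd hA n_gt0 Af.
  have f_gt0 := dvdn_gt0 n_gt0 f_dvd.
  rewrite -sum_mobiusA ?divn_gt0 ?(dvdn_leq n_gt0) // (big_regular_quo_mul hA) //.
  rewrite mulr_suml; apply: eq_bigl => e.
  by rewrite mulnC fA.
rewrite (big_regular_divn hA) // big_mkcond (bigD1_seq 1%N) ?divisors_uniq ?divisor1 //=.
rewrite divn1 divnn n_gt0 eqxx mul1r.
have /(regular_divn hA n_gt0) := regular_self hA n_gt0; rewrite divnn n_gt0 => A1.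
rewrite ifT ?inE // big_seq_cond big1 ?addr0 // => d /andP[].
rewrite -dvdn_divisors // => d_dvd d_neq; case: ifP => // _.
by rewrite divnA // mulKn // (negPf d_neq) mul0r.
Qed.

(** The maximum [g] is divisible by every competitor [d]: [lcmn d g] is again in [A n] and divides
    [j], so it is at most [g]. *)
Lemma gcdAP (j n : nat) : (0 < n)%N -> (0 < j)%N ->
  [/\ A n (gcdA A j%:Z n), (gcdA A j%:Z n %| j)%N &
    forall d, A n d -> (d %| j)%N -> (d %| gcdA A j%:Z n)%N].
Proof.
move=> n_gt0 j_gt0; set g := gcdA _ _ _.
have leg d : A n d -> (d %| j)%N -> (d <= g)%N.
  move=> Ad dj; apply: leq_bigmax_seq => /=.
    by rewrite -dvdn_divisors // (regular_dvd hA).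
  by apply/andP; split; rewrite ?inE.
have A1 : A n 1%N.
  by have /(regular_divn hA n_gt0) := regular_self hA n_gt0; rewrite divnn n_gt0.
have [Ag gj] : A n g /\ (g %| j)%N.
  (* An empty maximum would be 0; the divisor 1 excludes this. *)
  have : g = 0%N \/ A n g /\ (g %| j)%N.
    rewrite /g /gcdA; elim/big_ind: _ => [|x y hx hy|d /andP[dj]]; first by left.
    - by rewrite /maxn; case: ifP.
    - by rewrite inE; right.
  by case=> // g0; have := leg _ A1 (dvd1n j); rewrite g0.
split=> // d Ad dj.
have l_le : (lcmn d g <= g)%N.
  by apply: leg; rewrite ?dvdn_lcm ?dj //; apply: (regular_lcmn hA).
have g_gt0 := dvdn_gt0 j_gt0 gj.
have -> : g = lcmn d g; last exact: dvdn_lcml.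
apply/eqP; rewrite eqn_leq l_le dvdn_leq ?dvdn_lcmr // lcmn_gt0 g_gt0.
by rewrite (dvdn_gt0 j_gt0).
Qed.

(** This is [sum_mobiusAS] at the [A]-gcd [g]: a member of [A n] divides [g] iff it divides [j]. *)
Lemma rho_gcdA (S : set nat) (j n : nat) : (0 < n)%N -> (0 < j)%N ->
  rho S (gcdA A j%:Z n) =
  \sum_(d <- divisors n | (d \in A n) && (d %| j)%N) mobiusAS A S d.
Proof.
move=> n_gt0 j_gt0; have [Ag gj gP] := gcdAP n_gt0 j_gt0.
rewrite -sum_mobiusAS ?(dvdn_gt0 j_gt0) // (big_regular_sub hA _ _ n_gt0) //.
apply: eq_bigl => d; apply: andb_id2l; rewrite inE => Ad.
by apply/idP/idP; [move/dvdn_trans; apply | apply: gP].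
Qed.

End Mobius.

(** * Roots of unity *)

Lemma zetaX (R : realType) n j : zeta R n ^+ j =
  Complex (cos (2 * pi / n%:R * j%:R)) (sin (2 * pi / n%:R * j%:R)).
Proof.
elim: j => [|j IHj]; first by rewrite mulr0 cos0 sin0 expr0.
rewrite exprSr IHj /zeta; set t := 2 * pi / n%:R.
have -> : t * j.+1%:R = t * j%:R + t by rewrite -natr1 mulrDr mulr1.
rewrite cosD sinD.
by congr Complex; rewrite addrC.
Qed.

(** Half-angle formula: [cos x = 1 - 2 sin(x / 2)^2], with [x / 2] strictly between 0 and [pi]. *)
Lemma cos_lt1 (R : realType) (x : R) : 0 < x < 2 * pi -> cos x < 1.
Proof.
move=> /andP[x_gt0 x_lt].
have -> : x = (x / 2) *+ 2 by rewrite -mulr_natr divfK // pnatr_eq0.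
have s_gt0 : 0 < sin (x / 2) by apply: sin_gt0_pi; apply/andP; split; lra.
rewrite cos_mulr2n cos2sin2.
have := exprn_gt0 2 s_gt0.
lra.
Qed.

Lemma zeta_prim_root (R : realType) n : (0 < n)%N ->
  n.-primitive_root (zeta R n).
Proof.
move=> n_gt0; have n_neq0 : n%:R != 0 :> R by rewrite pnatr_eq0 -lt0n.
have npos : 0 < n%:R :> R by rewrite ltr0n.
apply/andP; split=> //; apply/forallP => i; apply/eqP.
rewrite unity_rootE zetaX.
have [->|i_neq] := eqVneq i.+1 n.
  rewrite divfK // mulrC -[pi * 2]/(pi * 2%:R) mulr_natr cos2pi sin2pi.
  by rewrite eqxx.
apply/negbTE/eqP => -[cos1 _].
have i_lt : (i.+1 < n)%N by rewrite ltn_neqAle i_neq ltn_ord.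
suff : cos (2 * pi / n%:R * i.+1%:R) < 1 :> R by rewrite cos1 ltxx.
have pi2_gt0 : 0 < 2 * pi :> R by rewrite mulr_gt0 // pi_gt0.
apply: cos_lt1; rewrite !mulr_gt0 ?invr_gt0 ?ltr0n ?pi_gt0 //=.
by rewrite mulrAC ltr_pdivrMr // ltr_pM2l // ltr_nat.
Qed.

Lemma prod_multiples_Xn_sub_1 (F : fieldType) n d (z : F) :
  n.-primitive_root z -> (d %| n)%N ->
  \prod_(1 <= j < n.+1 | (d %| j)%N) ('X - (z ^+ j)%:P) = 'X^(n %/ d) - 1.
Proof.
move=> prim_z d_dvd; have n_gt0 := prim_order_gt0 prim_z.
have d_gt0 := dvdn_gt0 n_gt0 d_dvd.
have prim_zd : (n %/ d).-primitive_root (z ^+ d).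
  have := dvdn_prim_root prim_z (dvdn_div d_dvd).
  by rewrite divnA // mulKn.
have q_gt0 : (0 < n %/ d)%N := prim_order_gt0 prim_zd.
rewrite -(factor_Xn_sub_1 prim_zd).
transitivity (\prod_(1 <= i < (n %/ d).+1) ('X - (z ^+ (d * i))%:P)).
  apply: (reindex_uniq_seq _ _ (h' := divn^~ d)); try exact: iota_uniq.
    move=> i; rewrite !mem_index_iota ltnS leq_divRL // mulnC => /andP[i_gt0 id_le] _.
    by rewrite ltnS muln_gt0 d_gt0 i_gt0 id_le dvdn_mulr // mulKn.
  move=> j; rewrite !mem_index_iota !ltnS => /andP[j_gt0 j_le] dj.
  by rewrite divn_gt0 // dvdn_leq //= leq_div2r // mulnC divnK.
case: (n %/ d)%N q_gt0 prim_zd => // m _ prim_zd.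
(* The exponents are [1, ..., n / d] on one side and [0, ..., n / d - 1] on the other; the top one
   gives the root 1. *)
rewrite big_add1 /= big_nat_recr //= [RHS]big_nat_recl //= mulrC.
rewrite exprM (prim_expr_order prim_zd) expr0; congr (_ * _).
by apply: eq_bigr => i _; rewrite exprM.
Qed.

(** * Factorization of [PhiAS] *)

Section PhiFactorization.
Variables (R : realType) (A : nat -> set nat) (hA : regular_system A).
Variables (S : set nat) (p q : nat -> nat).
Hypothesis mobiusAS_pq : forall d, mobiusAS A S d = (p d)%:Z - (q d)%:Z.

Lemma regular_sum_pq n j : (0 < n)%N -> (0 < j)%N ->
  ((gcdA A j%:Z n \in S) +
     \sum_(d <- divisors n | (d \in A n) && (d %| j)) q d =
   \sum_(d <- divisors n | (d \in A n) && (d %| j)) p d)%N.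
Proof.
move=> n_gt0 j_gt0; apply/eqP; rewrite -eqz_nat PoszD.
rewrite !(big_morph Posz PoszD erefl) eq_sym -subr_eq -sumrB.
under eq_bigr do rewrite -mobiusAS_pq.
by rewrite -rho_gcdA // /rho natz.
Qed.

(** Both products over [A n] split into the factors ['X - zeta ^ j]; [regular_sum_pq] compares the
    exponents for each [j]. *)
Lemma PhiAS_mul_prod n : (0 < n)%N ->
  PhiAS R A S n *
    \prod_(d <- divisors n | d \in A n) ('X^(n %/ d) - 1) ^+ q d =
  \prod_(d <- divisors n | d \in A n) ('X^(n %/ d) - 1) ^+ p d.
Proof.
move=> n_gt0; have prim_z := zeta_prim_root R n_gt0.
have prodE (e : nat -> nat) :
    \prod_(d <- divisors n | d \in A n) ('X^(n %/ d) - 1) ^+ e d =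
    \prod_(1 <= j < n.+1) ('X - (zeta R n ^+ j)%:P) ^+
       (\sum_(d <- divisors n | (d \in A n) && (d %| j)%N) e d).
  transitivity (\prod_(d <- divisors n | d \in A n)
      \prod_(1 <= j < n.+1 | (d %| j)%N) ('X - (zeta R n ^+ j)%:P) ^+ e d).
    apply: eq_bigr => d /set_mem /(regular_dvd hA n_gt0) d_dvd.
    by rewrite prodrXl (prod_multiples_Xn_sub_1 prim_z).
  rewrite (exchange_big_dep xpredT) //=.
  by apply: eq_bigr => j _; rewrite prodrXr.
rewrite !prodE /PhiAS big_mkcond -big_split /=; apply: eq_big_nat.
move=> j /andP[j_gt0 _]; rewrite -regular_sum_pq // exprD.
by case: (_ \in S).
Qed.

End PhiFactorization.

(** * Congruences modulo powers of ['X] *)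

Section Congruence.
Variable F : fieldType.
Implicit Types a b c d m : {poly F}.

Lemma eqmodpM m a b c d : a %% m = b %% m -> c %% m = d %% m ->
  (a * c) %% m = (b * d) %% m.
Proof.
move=> ab cd; rewrite -modp_mul cd modp_mul.
by rewrite ![_ * d]mulrC -modp_mul ab modp_mul.
Qed.

Lemma eqmodp_prod m (I : Type) (r : seq I) (P : pred I) (G H : I -> {poly F}) :
  (forall i, P i -> G i %% m = H i %% m) ->
  (\prod_(i <- r | P i) G i) %% m = (\prod_(i <- r | P i) H i) %% m.
Proof.
move=> GH; apply: (big_ind2 (fun a b => a %% m = b %% m)) => //.
by move=> a b c d; apply: eqmodpM.
Qed.

Lemma eqmodp_dvd m a b : (a %% m == b %% m) = (m %| a - b).
Proof. by rewrite -subr_eq0 -modpN -modpD. Qed.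

Lemma eqmodXn_cancel N a b c : ~~ root c 0 ->
  (a * c) %% 'X^N = (b * c) %% 'X^N -> a %% 'X^N = b %% 'X^N.
Proof.
move=> c0 /eqP; rewrite eqmodp_dvd -mulrBl Gauss_dvdpl.
  by rewrite -eqmodp_dvd => /eqP.
by rewrite coprimep_sym coprimep_expr // coprimepX.
Qed.

Lemma eqmodXn_coef N a b i : (i < N)%N ->
  a %% 'X^N = b %% 'X^N -> a`_i = b`_i.
Proof.
move=> iN /eqP; rewrite eqmodp_dvd => /dvdpP[c abE].
by apply/eqP; rewrite -subr_eq0 -coefB abE coefMXn iN.
Qed.

End Congruence.

Lemma dvdp_Xn_scale (F : fieldType) N i (c : F) :
  (N <= i)%N -> ('X^N : {poly F}) %| c *: 'X^i.
Proof. by move=> Ni; rewrite -mul_polyC dvdp_mull // dvdp_exp2l. Qed.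

(** * Truncated binomial series *)

Section BinomialSeries.
Variable F : numFieldType.
Implicit Types (e : int) (d k j : nat).

Lemma gbinom0r e : gbinom F e 0 = 1.
Proof. by rewrite /gbinom big_ord0 divr1. Qed.

Lemma gbinom0l j : gbinom F 0 j = (j == 0%N)%:R.
Proof.
case: j => [|j]; first exact: gbinom0r.
by rewrite /gbinom big_ord_recl subrr !mul0r.
Qed.

(** Pascal's rule: all three terms share the factor [e (e - 1) ... (e - j + 1)]. *)
Lemma gbinomS e j : gbinom F (e + 1) j.+1 = gbinom F e j.+1 + gbinom F e j.
Proof.
rewrite /gbinom big_ord_recl big_ord_recr /= factS natrM.
have -> : \prod_(i < j) ((e + 1)%:~R - (lift ord0 i)%:R) =
    \prod_(i < j) (e%:~R - i%:R) :> F.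
  by apply: eq_bigr => i _; rewrite lift0 intrD -natr1; ring.
rewrite intrD; field.
by rewrite nat1r !pnatr_eq0 -lt0n fact_gt0.
Qed.

(** The series of [(1 - 'X^d) ^ e] cut by number of terms, not by degree, to match the range of
    [j_d] in the theorem. For [d > 0] the omitted terms have degree above [k]. *)
Definition binom_trunc k d e : {poly F} :=
  \sum_(j < k.+1) ((-1) ^+ j * gbinom F e j) *: 'X^(d * j).

Lemma binom_trunc0 k d : binom_trunc k d 0 = 1.
Proof.
rewrite /binom_trunc big_ord_recl gbinom0r muln0 mulr1 scale1r big1 ?addr0 //.
by move=> i _; rewrite gbinom0l mulr0 scale0r.
Qed.

Lemma binom_trunc_large k d e : (k < d)%N ->
  binom_trunc k d e %% 'X^(k.+1) = 1 %% 'X^(k.+1).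
Proof.
move=> kd; apply/eqP; rewrite eqmodp_dvd /binom_trunc big_ord_recl.
rewrite gbinom0r muln0 mulr1 scale1r addrC addKr.
elim/big_ind: _ => [|a b|i _]; [exact: dvdp0|exact: dvdp_add|].
by apply: dvdp_Xn_scale; rewrite (leq_trans kd) // leq_pmulr.
Qed.

(** By Pascal's rule the difference collapses to one term, of degree [d * (k + 1)]. *)
Lemma binom_truncM k d e : (0 < d)%N ->
  (binom_trunc k d e * (1 - 'X^d)) %% 'X^(k.+1) = binom_trunc k d (e + 1) %% 'X^(k.+1).
Proof.
move=> d_gt0; apply/eqP; rewrite eqmodp_dvd.
pose c e j := (-1) ^+ j * gbinom F e j.
have -> : binom_trunc k d e * (1 - 'X^d) - binom_trunc k d (e + 1) =
    - (c e k *: 'X^(d * k.+1)).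
  have QX : binom_trunc k d e * 'X^d =
      \sum_(j < k) c e j *: 'X^(d * j.+1) + c e k *: 'X^(d * k.+1).
    rewrite /binom_trunc mulr_suml big_ord_recr /= -scalerAl -exprD -mulnSr.
    by congr (_ + _); apply: eq_bigr => j _; rewrite -scalerAl -exprD -mulnSr.
  have Q'E : binom_trunc k d (e + 1) =
      binom_trunc k d e - \sum_(j < k) c e j *: 'X^(d * j.+1).
    rewrite /binom_trunc !big_ord_recl !gbinom0r -addrA -sumrB; congr (_ + _).
    apply: eq_bigr => j _; rewrite lift0 gbinomS /c exprS -scalerBl.
    by congr (_ *: _); ring.
  by rewrite mulrBr mulr1 QX Q'E; ring.
by rewrite dvdpNr dvdp_Xn_scale // leq_pmull.
Qed.

Lemma binom_truncMX k d e r : (0 < d)%N ->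
  (binom_trunc k d e * (1 - 'X^d) ^+ r) %% 'X^(k.+1) =
  binom_trunc k d (e + r%:Z) %% 'X^(k.+1).
Proof.
move=> d_gt0; elim: r => [|r IHr]; first by rewrite expr0 mulr1 addr0.
rewrite exprSr mulrA (eqmodpM IHr (erefl ((1 - 'X^d) %% 'X^(k.+1)))) binom_truncM //.
by rewrite -addrA -natz natr1 natz.
Qed.

(** The exponent [p] is reached from [p - q] by [q] multiplications and from 0 by [p] of them. *)
Lemma binom_trunc_quotient k d (p q : nat) : (0 < d)%N ->
  (binom_trunc k d (p%:Z - q%:Z) * (1 - 'X^d) ^+ q) %% 'X^(k.+1) =
  ((1 - 'X^d) ^+ p) %% 'X^(k.+1).
Proof.
move=> d_gt0; rewrite binom_truncMX // subrK.
by rewrite -[in LHS](add0r p%:Z) -binom_truncMX // binom_trunc0 mul1r.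
Qed.

(** Distributing the product, a choice of indices [j] yields a monomial of degree
    [\sum_d d.+1 * j d]. *)
Lemma coef_prod_binom_trunc k (e : nat -> int) :
  (\prod_(d < k) binom_trunc k d.+1 (e d.+1))`_k =
  \sum_(j : {ffun 'I_k -> 'I_k.+1} | (\sum_(d < k) d.+1 * j d)%N == k)
    \prod_(d < k) ((-1) ^+ (j d) * gbinom F (e d.+1) (j d)).
Proof.
rewrite bigA_distr_bigA /= coef_sum [RHS]big_mkcond; apply: eq_bigr => j _.
rewrite scaler_prod prodrXr coefZ coefXn eq_sym.
by case: eqP => _; rewrite ?mulr1 ?mulr0.
Qed.

End BinomialSeries.

(** * Coefficients of [PhiAS] *)

(** Indices outside [A n] have exponent 0 and contribute 1; members of [A n] above [k] contribute 1
    modulo ['X^(k + 1)]. Then [d |-> n / d] matches the two products. *)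
Lemma prod_binom_trunc_regular (F : numFieldType) (A : nat -> set nat)
    (S : set nat) n k : regular_system A -> (0 < n)%N ->
  (\prod_(d < k) binom_trunc F k d.+1 (mobiusAS_quo A S n d.+1)) %% 'X^(k.+1) =
  (\prod_(d <- divisors n | d \in A n)
     binom_trunc F k (n %/ d) (mobiusAS A S d)) %% 'X^(k.+1).
Proof.
move=> hA n_gt0.
have -> : \prod_(d < k) binom_trunc F k d.+1 (mobiusAS_quo A S n d.+1) =
    \prod_(d <- divisors n | (d \in A n) && (d <= k)%N)
      binom_trunc F k d (mobiusAS A S (n %/ d)).
  rewrite -(big_mkord xpredT (fun d => binom_trunc F k d.+1 (mobiusAS_quo A S n d.+1))).
  rewrite -(big_add1 _ _ 0 k.+1 xpredT (fun d => binom_trunc F k d (mobiusAS_quo A S n d))).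
  transitivity (\prod_(1 <= d < k.+1 | d \in A n)
      binom_trunc F k d (mobiusAS A S (n %/ d))).
    rewrite [RHS]big_mkcond; apply: eq_bigr => d _.
    by rewrite /mobiusAS_quo; case: ifP; rewrite ?binom_trunc0.
  apply: (reindex_uniq_seq _ _ (h := id) (h' := id)).
  - exact: iota_uniq.
  - exact: divisors_uniq.
  - move=> d; rewrite -dvdn_divisors // => d_dvd /andP[Ad dk].
    by rewrite mem_index_iota ltnS dk (dvdn_gt0 n_gt0).
  - move=> d; rewrite mem_index_iota ltnS => /andP[_ ->] Ad.
    by rewrite -dvdn_divisors // (regular_dvd hA) ?Ad //; apply: set_mem.
rewrite [in RHS](big_regular_divn hA) // big_mkcondr.
rewrite big_seq_cond [in RHS]big_seq_cond; apply: eqmodp_prod => d /andP[].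
rewrite -dvdn_divisors // => d_dvd _; rewrite divnA // mulKn //.
by case: leqP => // kd; rewrite binom_trunc_large.
Qed.

(** Turning each ['X^m - 1] into [1 - 'X^m] costs the signs with exponents [\sum q d] and
    [\sum p d]. These sums differ by [n \in S], by [regular_sum_pq] at [j = n], where the [A]-gcd is
    [n]. *)
Lemma PhiAS_mul_prod_1_sub_Xn (R : realType) (A : nat -> set nat) (S : set nat)
    (p q : nat -> nat) n : regular_system A ->
  (forall d, mobiusAS A S d = (p d)%:Z - (q d)%:Z) -> (0 < n)%N ->
  PhiAS R A S n *
    \prod_(d <- divisors n | d \in A n) (1 - 'X^(n %/ d)) ^+ q d =
  (-1) ^+ (n \in S) *:
    \prod_(d <- divisors n | d \in A n) (1 - 'X^(n %/ d)) ^+ p d.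
Proof.
move=> hA pq n_gt0.
have prodN (e : nat -> nat) :
    \prod_(d <- divisors n | d \in A n) (1 - 'X^(n %/ d)) ^+ e d =
    (-1) ^+ (\sum_(d <- divisors n | d \in A n) e d)%N *:
    \prod_(d <- divisors n | d \in A n) ('X^(n %/ d) - 1) ^+ e d :> {poly R[i]}.
  rewrite -prodrXr -scaler_prod; apply: eq_bigr => d _.
  by rewrite -exprZn scaleN1r opprB.
have sumE (e : nat -> nat) : (\sum_(d <- divisors n | d \in A n) e d =
    \sum_(d <- divisors n | (d \in A n) && (d %| n)) e d)%N.
  rewrite big_seq_cond [RHS]big_seq_cond; apply: eq_bigl => d.
  by have [|] := boolP (d \in divisors n); rewrite -dvdn_divisors // => ->; rewrite andbT.
have gcdAn : gcdA A n%:Z n = n.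
  have [_ g_dvd gP] := gcdAP hA n_gt0 n_gt0.
  by apply/eqP; rewrite eqn_dvd g_dvd gP //; apply: regular_self.
rewrite !prodN -scalerAr (PhiAS_mul_prod _ hA pq) // scalerA; congr (_ *: _).
rewrite [in RHS]sumE -(regular_sum_pq hA pq) // gcdAn -sumE exprD mulrA.
by rewrite -expr2 sqrr_sign mul1r.
Qed.

(* The index d : 'I_k stands for d.+1 in {1, ..., k}; each j_d is at most k
   because j_1 + 2 j_2 + ... + k j_k = k. *)
Theorem theorem11 (R : realType) (A : nat -> set nat) (S : set nat) (n : nat)
    (hA : regular_system A)
    (hS_pos : S `<=` [set m | (0 < m)%N]) (hS_ne : S !=set0)
    (hn : (0 < n)%N) (k : nat) (hk : (0 < k)%N) :
  (PhiAS R A S n)`_k =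
  (-1) ^+ (n \in S) *
  \sum_(j : {ffun 'I_k -> 'I_k.+1} | (\sum_(d < k) d.+1 * j d)%N == k)
    \prod_(d < k)
      ((-1) ^+ (j d) * gbinom R[i] (mobiusAS_quo A S n d.+1) (j d)).
Proof.
pose p d := if mobiusAS A S d is Posz m then m else 0%N.
(* Positive and negative parts; [Negz m] stands for [-(m + 1)]. *)
pose q d := if mobiusAS A S d is Negz m then m.+1 else 0%N.
have pq d : mobiusAS A S d = (p d)%:Z - (q d)%:Z.
  by rewrite /p /q; case: mobiusAS => m; rewrite ?subr0 // NegzE sub0r.
have quo_gt0 d : d \in divisors n -> (0 < n %/ d)%N.
  rewrite -dvdn_divisors // => d_dvd.
  by rewrite divn_gt0 ?(dvdn_gt0 hn) // dvdn_leq.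
rewrite -coef_prod_binom_trunc -coefZ; apply: (eqmodXn_coef (ltnSn k)).
(* [N] clears the negative exponents on both sides; its value at 0 is nonzero since every [n / d] is
   positive, so it cancels modulo ['X^(k + 1)]. *)
pose N : {poly R[i]} :=
  \prod_(d <- divisors n | d \in A n) (1 - 'X^(n %/ d)) ^+ q d.
apply: (@eqmodXn_cancel _ _ _ _ N).
  rewrite rootE horner_prod prodf_seq_neq0; apply/allP => d /quo_gt0 d_gt0.
  apply/implyP => _.
  by rewrite horner_exp !hornerE expr0n gtn_eqF // subr0 expr1n oner_eq0.
rewrite (PhiAS_mul_prod_1_sub_Xn R hA pq) // -scalerAl !modpZl; congr (_ *: _).
rewrite (eqmodpM (prod_binom_trunc_regular _ S k hA hn) erefl).
rewrite -big_split /= big_seq_cond [in RHS]big_seq_cond; apply/esym.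
apply: eqmodp_prod => d /andP[/quo_gt0 d_gt0 _].
by rewrite pq binom_trunc_quotient.
Qed.
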